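(* Let $d\ge1$ and let $\lambda_1,\dots,\lambda_d$ be non-zero, pairwise distinct real numbers, and let $F_\infty=\sum_{i=1}^d\lambda_i(N_i^2-1)$ with $N_1,\dots,N_d$ i.i.d. standard Gaussian. Consider the two differential operators associated with $F_\infty$: the operator obtained from Malliavin calculus, $$\mathcal{A}_\infty f(x)=\sum_{l=2}^{d+1}(b_l-a_{l-1}x)f^{(d+2-l)}(x)-a_{d+1}xf(x),$$ and the operator obtained from the Fourier approach, $$\mathcal{L}f(x)=\Big(x+\sum_{i=1}^d\lambda_i\Big)(-1)^d2^d\Big(\prod_{j=1}^d\lambda_j\Big)f^{(d)}(x)+\sum_{l=1}^{d-1}2^l(-1)^l\Big(x\,e_l(\lambda_1,\dots,\lambda_d)+\sum_{k=1}^d\lambda_k\big(e_l(\lambda_1,\dots,\lambda_d)-e_l(\underline{\lambda}_k)\big)\Big)f^{(l)}(x)+xf(x).$$ Then $\mathcal{A}_\infty$ and $\mathcal{L}$ coincide up to a normalizing constant: there is a non-zero real constant $K$ such that $\mathcal{A}_\infty f=K\,\mathcal{L}f$ for every smooth function $f:\mathbb{R}\to\mathbb{R}$.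
   Context: Let $P(x)=x\prod_{i=1}^d(x-\lambda_i)$. For $1\le l\le d+1$, $a_l=\frac{P^{(l)}(0)}{l!\,2^{l-1}}$; for $2\le l\le d+1$, $b_l=\sum_{r=l}^{d+1}\frac{a_r}{(r-l+1)!}\kappa_{r-l+2}(F_\infty)$, where $\kappa_r(F_\infty)$ is the $r$-th cumulant of $F_\infty$. For real numbers $x_1,\dots,x_n$, $e_k(x_1,\dots,x_n)=\sum_{1\le i_1<\dots<i_k\le n}x_{i_1}\cdots x_{i_k}$, with $e_0=1$. $\underline{\lambda}_k=(\lambda_1,\dots,\lambda_{k-1},\lambda_{k+1},\dots,\lambda_d)$ is the $(d-1)$-tuple with $\lambda_k$ removed. *)

(* Defs.v *)
From mathcomp Require Export all_boot all_order all_algebra.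
From mathcomp Require Export all_classical all_reals all_analysis.
Export numFieldNormedType.Exports.

Set Implicit Arguments.
Unset Strict Implicit.
Unset Printing Implicit Defensive.

Import Order.TTheory GRing.Theory Num.Theory.

Local Open Scope classical_set_scope.
Local Open Scope ring_scope.

Definition smooth (R : realType) (f : R -> R) : Prop :=
  forall (n : nat) (x : R), derivable (derive1n n f) x 1.

Definition mutually_independent (disp : measure_display)
    (T : measurableType disp) (R : realType) (P : probability T R)
    (I : finType) (X : I -> {RV P >-> R}) : Prop :=
  forall (J : {set I}) (B : I -> set R),
    (forall i, i \in J -> measurable (B i)) ->
    P (\bigcap_(i in [set i | i \in J]) (X i @^-1` B i)) =
    (\prod_(i in J) P (X i @^-1` B i))%E.

Definition standard_gaussian (disp : measure_display)
    (T : measurableType disp) (R : realType) (P : probability T R)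
    (X : {RV P >-> R}) : Prop :=
  forall B : set R, measurable B -> distribution P X B = normal_prob 0 1 B.

(* Derivatives at 0 of the cumulant generating function t |-> ln E[exp(tX)].
   Only meaningful when the moment generating function is finite near 0, as it
   is for the random variable F_infty below; [fine] and [ln] are total. *)
Definition cumulant (disp : measure_display) (T : measurableType disp)
    (R : realType) (P : probability T R) (X : T -> R) (r : nat) : R :=
  derive1n r (fun t : R => ln (fine (mmt_gen_fun P X t))) 0.

Definition F_infty (T : Type) (R : realType) (d : nat) (lambda : 'I_d -> R)
    (N : 'I_d -> T -> R) : T -> R :=
  fun w => \sum_(i < d) lambda i * (N i w ^+ 2 - 1).

Definition P_poly (R : realType) (d : nat) (lambda : 'I_d -> R) : {poly R} :=
  'X * \prod_(i < d) ('X - (lambda i)%:P).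

Definition coef_a (R : realType) (d : nat) (lambda : 'I_d -> R) (l : nat) : R :=
  (derivn l (P_poly lambda)).[0] / (l`!%:R * 2 ^+ l.-1).

Definition coef_b (disp : measure_display) (T : measurableType disp)
    (R : realType) (P : probability T R) (d : nat) (lambda : 'I_d -> R)
    (N : 'I_d -> {RV P >-> R}) (l : nat) : R :=
  \sum_(l <= r < d.+2)
    coef_a lambda r / ((r - l).+1)`!%:R
      * cumulant P (F_infty lambda N) (r - l).+2.

(* Increasing k-tuples of indices are encoded as k-element sets of indices. *)
Definition elem_sym (R : realType) (n : nat) (x : 'I_n -> R) (k : nat) : R :=
  \sum_(A : {set 'I_n} | #|A| == k) \prod_(i in A) x i.

Definition remove_at (R : realType) (d : nat) (lambda : 'I_d -> R)
    (k : 'I_d) : 'I_d.-1 -> R :=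
  fun j => lambda (lift k j).

Definition malliavin_op (disp : measure_display) (T : measurableType disp)
    (R : realType) (P : probability T R) (d : nat) (lambda : 'I_d -> R)
    (N : 'I_d -> {RV P >-> R}) (f : R -> R) (x : R) : R :=
  \sum_(2 <= l < d.+2)
    (coef_b lambda N l - coef_a lambda l.-1 * x) * derive1n (d.+2 - l) f x
  - coef_a lambda d.+1 * x * f x.

Definition fourier_op (R : realType) (d : nat) (lambda : 'I_d -> R)
    (f : R -> R) (x : R) : R :=
  (x + \sum_(i < d) lambda i) * (-1) ^+ d * 2 ^+ d * (\prod_(j < d) lambda j)
    * derive1n d f x
  + \sum_(1 <= l < d)
      2 ^+ l * (-1) ^+ l
      * (x * elem_sym lambda l
         + \sum_(k < d)
             lambda k * (elem_sym lambda l - elem_sym (remove_at lambda k) l))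
      * derive1n l f x
  + x * f x.

(* Main.v *)
(** For [t] near [0], independence and the Gaussian integral give
    [ln E(exp(t F)) = - sum_i (t lambda_i + ln (1 - 2 t lambda_i) / 2)], whence
    [kappa_r = 2^(r-1) (r-1)! sum_i lambda_i^r] for [r >= 2].  By Vieta,
    [a_(d+1-m) = (-1)^m e_m / 2^(d-m)], so that [b_l] becomes a combination of
    products of elementary symmetric functions and power sums.  The relation
    [e_m - e_m(without k) = lambda_k e_(m-1)(without k)], iterated, expresses
    the coefficients of [L] in the same way, and comparison gives [K = - 2^(-d)]. *)
Require Import Defs.
From mathcomp Require Import measurable_realfun ring zify lra.

Set Implicit Arguments.
Unset Strict Implicit.
Unset Printing Implicit Defensive.

Import Order.TTheory GRing.Theory Num.Theory.

Local Open Scope ring_scope.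

(** * Elementary symmetric polynomials and the coefficients [coef_a] *)

Lemma coef_prod_1DX (R : realType) (n : nat) (x : 'I_n -> R) (k : nat) :
  (\prod_(i < n) (1 + (x i)%:P * 'X))`_k = elem_sym x k.
Proof.
under eq_bigr do rewrite addrC.
rewrite bigA_distr /elem_sym coef_sum [RHS]big_mkcond /=.
apply: eq_bigr => A _.
rewrite (bigID (mem A)) /= [X in _ * X]big1 ?mulr1; last first.
  by move=> i /negbTE ->.
under eq_bigr => i iA do rewrite iA.
rewrite big_split /= prodr_const -(rmorph_prod (@polyC R)) coefCM coefXn.
by rewrite eq_sym; case: eqP; rewrite ?mulr1 ?mulr0.
Qed.

(** Vieta's formula: in the expanded product, [A] collects the factors contributing [- x i], leaving
    degree [n - #|A|]. *)
Lemma coef_prod_XsubC (R : realType) (n : nat) (x : 'I_n -> R) (k : nat) :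
  (k <= n)%N ->
  (\prod_(i < n) ('X - (x i)%:P))`_(n - k) = (-1) ^+ k * elem_sym x k.
Proof.
move=> kn.
under eq_bigr do rewrite addrC.
rewrite bigA_distr /elem_sym coef_sum mulr_sumr [RHS]big_mkcond /=.
apply: eq_bigr => A _.
rewrite (bigID (mem A)) /=.
under eq_bigr => i iA do rewrite iA -polyCN.
under [X in _ * X]eq_bigr => i iA do rewrite (negbTE iA).
rewrite -(rmorph_prod (@polyC R)) prodr_const coefCM coefXn prodrN.
have cA : (#|A| + #|[pred i | i \notin A]|)%N = n.
  by rewrite -[RHS]card_ord -(cardC A); congr addn; apply: eq_card => i.
have An : (#|A| <= n)%N by rewrite -[X in (_ <= X)%N]cA leq_addr.
have -> : #|[pred i | i \notin A]| = (n - #|A|)%N.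
  by rewrite -[X in (X - _)%N]cA addKn.
have -> : (n - k == n - #|A|)%N = (#|A| == k).
  by apply/eqP/eqP => [h|->//]; rewrite -(subKn An) -h subKn.
by case: eqP => [->|]; rewrite ?mulr1 ?mulr0.
Qed.

Lemma elem_sym0 (R : realType) (n : nat) (x : 'I_n -> R) : elem_sym x 0 = 1.
Proof.
rewrite -coef_prod_1DX -horner_coef0 horner_prod big1 // => i _.
by rewrite !hornerE.
Qed.

(** Compare coefficients after pulling the factor of index [k] out of the generating product. *)
Lemma elem_sym_remove_at (R : realType) (d : nat) (x : 'I_d -> R) (k : 'I_d) n :
  elem_sym x n.+1 =
  elem_sym (remove_at x k) n.+1 + x k * elem_sym (remove_at x k) n.
Proof.
case: d x k => [x []//|d x k].
rewrite -!coef_prod_1DX (bigD1_ord k) //= mulrDl mul1r coefD.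
by rewrite -mulrA coefCM coefXM.
Qed.

(** Iteration of the preceding recursion, that is, division of the generating product by
    [1 + x k X]. Trading the removed entry for powers of [x k] is what makes the power sums of the
    cumulants appear in [fourier_op]. *)
Lemma elem_sym_remove_atE (R : realType) (d : nat) (x : 'I_d -> R) (k : 'I_d)
    n :
  elem_sym (remove_at x k) n =
  \sum_(i < n.+1) (- x k) ^+ i * elem_sym x (n - i).
Proof.
elim: n => [|n IH]; first by rewrite big_ord1 mul1r !elem_sym0.
rewrite big_ord_recl mul1r subn0 (elem_sym_remove_at x k).
rewrite IH -addrA mulr_sumr -big_split /= big1 ?addr0// => i _.
by rewrite /bump /= add1n subSS exprS mulNr mulrA mulNr addrN.
Qed.

Lemma elem_sym_eq0 (R : realType) (n : nat) (x : 'I_n -> R) (k : nat) :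
  (n < k)%N -> elem_sym x k = 0.
Proof.
move=> nk; apply: big1 => A /eqP Ak.
by have := max_card (mem A); rewrite card_ord Ak leqNgt nk.
Qed.

Lemma coef_aE (R : realType) (d : nat) (lambda : 'I_d -> R) (m : nat) :
  (m <= d)%N ->
  coef_a lambda (d - m).+1 = (-1) ^+ m * elem_sym lambda m / 2 ^+ (d - m).
Proof.
move=> md; rewrite /coef_a /P_poly -coef_prod_XsubC //.
rewrite horner_coef0 coef_derivn addn0 ffactnn coefXM /=.
have f0 : (d - m).+1`!%:R != 0 :> R by rewrite pnatr_eq0 -lt0n fact_gt0.
by rewrite -[X in X / _]mulr_natr [X in X / _]mulrC -mulf_div divff ?mul1r.
Qed.

(** * Term-by-term comparison of the two operators, given the cumulants *)

Section OperatorComparison.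
Variables (R : realType) (disp : measure_display) (T : measurableType disp).
Variables (P : probability T R) (d : nat) (lambda : 'I_d -> R).
Variable N : 'I_d -> {RV P >-> R}.

Hypothesis cumulantE : forall r,
  cumulant P (F_infty lambda N) r.+2 =
  2 ^+ r.+1 * r.+1`!%:R * \sum_(i < d) lambda i ^+ r.+2.

(** For [l = d + 1 - m] and [r = l + i], the factorial in the cumulant cancels [(i + 1)!], leaving
    [e_(m-i)] times the sum of the [lambda_k ^ (i + 2)], up to signs and powers of 2. Summing over
    [i] first gives [lambda_k ^ 2] times [e_m] without [lambda_k], hence the difference on the
    right. *)
Lemma coef_bE (m : nat) : (m < d)%N ->
  coef_b lambda N (d - m).+1 =
  (-1) ^+ m * 2 ^+ m.+1 / 2 ^+ d *
  \sum_(k < d) lambda k *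
    (elem_sym lambda m.+1 - elem_sym (remove_at lambda k) m.+1).
Proof.
move=> md; rewrite /coef_b -{1}[(d - m).+1]add0n big_addn.
have -> : (d.+2 - (d - m).+1 = m.+1)%N by lia.
rewrite big_mkord.
under [in RHS]eq_bigr => k _.
  rewrite (elem_sym_remove_at lambda k) addrC addKr elem_sym_remove_atE.
  over.
transitivity (\sum_(i < m.+1) \sum_(k < d)
   (-1) ^+ m * 2 ^+ m.+1 / 2 ^+ d * (lambda k * (lambda k *
     ((- lambda k) ^+ i * elem_sym lambda (m - i))))); last first.
  rewrite exchange_big /=; rewrite mulr_sumr; apply: eq_bigr => k _.
  by rewrite -mulr_sumr -!mulr_sumr.
apply: eq_bigr => i _.
have im : (i <= m)%N by rewrite -ltnS.
have -> : (i + (d - m).+1 = (d - (m - i)).+1)%N by lia.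
rewrite coef_aE; last lia.
have -> : ((d - (m - i)).+1 - (d - m).+1 = i)%N by lia.
rewrite cumulantE.
move: (elem_sym lambda (m - i)) => e.
rewrite !mulr_sumr; apply: eq_bigr => k _.
have -> : 2 ^+ d = 2 ^+ (d - (m - i)) * 2 ^+ (m - i) :> R.
  by rewrite -exprD; congr (_ ^+ _); lia.
have -> : 2 ^+ m.+1 = 2 ^+ (m - i) * 2 ^+ i.+1 :> R.
  by rewrite -exprD; congr (_ ^+ _); lia.
have -> : (-1) ^+ m = (-1) ^+ (m - i) * (-1) ^+ i :> R.
  by rewrite -exprD; congr (_ ^+ _); lia.
have f0 : i.+1`!%:R != 0 :> R by rewrite pnatr_eq0 -lt0n fact_gt0.
have p0 n : 2 ^+ n != 0 :> R by rewrite expf_neq0 // pnatr_eq0.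
rewrite (exprNn (lambda k)) 2!(exprS (lambda k)).
(* The sign [(-1) ^ i] occurs twice on the right, from [(-1) ^ m] and from [(- lambda k) ^ i];
   splitting on the parity of [i] makes the two cancel. *)
rewrite -(signr_odd R i).
move: (p0 (d - (m - i))%N) (p0 (m - i)%N) f0.
move: (_ ^+ (m - i)) (2 ^+ (d - _)) (2 ^+ (m - i)) (_`!%:R) => s a b g a0 b0 g0.
by case: (odd i); rewrite /= ?expr0 ?expr1; field; rewrite a0 b0 g0.
Qed.

Lemma malliavin_op_fourier_op (hd : (0 < d)%N) (f : R -> R) (x : R) :
  malliavin_op lambda N f x = - (2 ^+ d)^-1 * fourier_op lambda f x.
Proof.
pose c m := \sum_(k < d) lambda k *
  (elem_sym lambda m - elem_sym (remove_at lambda k) m).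
pose F m := 2 ^+ m * (-1) ^+ m * (x * elem_sym lambda m + c m) * derive1n m f x.
(* The leading term fits the pattern of the others: [e_d] is the full product, and [e_d] of the
   [d - 1] remaining entries is 0. *)
have -> : fourier_op lambda f x = \sum_(1 <= m < d.+1) F m + x * f x.
  rewrite /fourier_op big_nat_recr //= [X in X + x * f x]addrC; do 2 congr +%R.
  have ed : elem_sym lambda d = \prod_(j < d) lambda j.
    rewrite /elem_sym (big_pred1 [set: 'I_d]) => [|A].
      by apply: eq_bigl => i; rewrite inE.
    have := max_card (mem A); rewrite card_ord => Ad.
    by rewrite /= eqEcard finset.subsetT cardsT card_ord eqn_leq Ad.
  have cd : c d = (\sum_(i < d) lambda i) * \prod_(j < d) lambda j.
    rewrite /c ed mulr_suml; apply: eq_bigr => k _.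
    by rewrite (@elem_sym_eq0 _ d.-1) ?prednK// subr0.
  by rewrite /F cd ed; ring.
rewrite /malliavin_op mulrDr; congr (_ + _); last first.
  have := @coef_aE R d lambda 0 isT; rewrite subn0 elem_sym0 expr0 mulr1 => ->.
  by rewrite mul1r mulNr mulrA.
(* Reversal by [l = d + 2 - m] indexes both sums by the order [m] of the derivative. *)
rewrite big_nat_rev big_add1 /= mulr_sumr.
rewrite big_nat [RHS]big_nat; apply: eq_bigr => m /andP[m0 md].
case: m m0 md => // m _; rewrite ltnS => md.
have -> : (2 + d.+2 - m.+3 = (d - m).+1)%N by lia.
have -> : (d.+2 - (d - m).+1 = m.+1)%N by lia.
rewrite coef_bE// /F -/(c _) /=.
have -> : (d - m = (d - m.+1).+1)%N by lia.
rewrite coef_aE//.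
have -> : 2 ^+ d = 2 ^+ (d - m.+1) * 2 ^+ m.+1 :> R by rewrite -exprD subnK.
have p0 n : 2 ^+ n != 0 :> R by rewrite expf_neq0 // pnatr_eq0.
rewrite (exprS (-1)); field.
by rewrite !p0.
Qed.

End OperatorComparison.

(** * Higher derivatives of the cumulant generating function near 0 *)

Lemma near_derive1 (R : realType) (M F G : R -> R) (a : R) :
  (\forall t \near a, M t = F t) ->
  (\forall t \near a, is_derive (t : R) (1 : R) F (G t)) ->
  \forall t \near a, derive1 M t = G t.
Proof.
(* Differentiation at [t] needs the equality around [t], not only at it. The conclusion has the
   shape of the first hypothesis, so the lemma can be iterated. *)
move=> /nbhs_interior MF FG; near=> t.
rewrite derive1E (@near_eq_derive _ _ _ M F).
  have FGt : is_derive (t : R) (1 : R) F (G t) by near: t.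
  by rewrite derive_val.
by near: t.
Unshelve. all: by end_near. Qed.

Section Cgf.
Variables (R : realType) (d : nat) (lambda : 'I_d -> R).

Lemma near0_1sub_gt0 :
  \forall t \near (0 : R), forall i, 0 < 1 - 2 * (t * lambda i).
Proof.
have near_i i : \forall t \near (0 : R), 0 < 1 - 2 * (t * lambda i).
  have cf : (1 - 2 * (t * lambda i) @[t --> (0 : R)] -->
             1 - 2 * (0 * lambda i))%classic.
    by apply: cvgB; [exact: cvg_cst|apply: cvgMr; apply: cvgMl; exact: cvg_id].
  rewrite mul0r mulr0 subr0 in cf.
  exact: (cvgr_gt _ cf).
exact: (filter_forall _ near_i).
Qed.

Lemma is_derive_1sub (l t : R) :
  is_derive t 1 (fun s => 1 - 2 * (s * l)) (- (2 * l)).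
Proof.
rewrite (_ : (fun s => _) = cst 1 - (2 * l) \*: (@id R)); last first.
  by apply/funext => s; rewrite !fctE /= [s * l]mulrC mulrA.
by apply: is_derive_eq; rewrite sub0r scaler1.
Qed.

Lemma is_derive_1subV (l t : R) : 1 - 2 * (t * l) != 0 ->
  is_derive t 1 (fun s => (1 - 2 * (s * l))^-1)
    (2 * l * (1 - 2 * (t * l))^-1 ^+ 2).
Proof.
move=> t0.
have := is_deriveV (f := fun s => 1 - 2 * (s * l)) t0 (is_derive_1sub l t).
by move=> h; apply: is_derive_eq; rewrite /GRing.scale /= mulrNN -exprVn mulrC.
Qed.

Variable M : R -> R.
Hypothesis ME : \forall t \near (0 : R), M t =
  \sum_(i < d) (- (t * lambda i) - ln (1 - 2 * (t * lambda i)) / 2).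

(** Order one stands apart: the constant [- lambda i], due to the centring, survives here only and
    vanishes at the next differentiation. *)
Lemma derive1_cgf_near0 : \forall t \near (0 : R),
  derive1n 1 M t =
  \sum_(i < d) (lambda i * (1 - 2 * (t * lambda i))^-1 - lambda i).
Proof.
apply: (near_derive1 ME); near=> t.
have tpos : forall i, 0 < 1 - 2 * (t * lambda i).
  by near: t; exact: near0_1sub_gt0.
rewrite -fct_sumE.
apply: is_derive_sum => i.
have dln := is_derive1_comp (g := fun s => 1 - 2 * (s * lambda i))
  (is_derive1_ln (tpos i)) (is_derive_1sub (lambda i) t).
rewrite (_ : (fun s => _) = (- lambda i) \*: (@id R) -
  2^-1 \*: (@ln R \o (fun s => 1 - 2 * (s * lambda i)))); last first.
  by apply/funext => s; rewrite !fctE /= /GRing.scale /=; ring.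
apply: is_derive_eq; rewrite /GRing.scale /=.
by field; rewrite gt_eqF.
Unshelve. all: by end_near. Qed.

(** Differentiating the inverse power of order [r + 2] brings out [2 (r + 2) lambda_i] and one more
    inverse power, which builds up the factorial and the power of 2. *)
Lemma derive1n_cgf_near0 r : \forall t \near (0 : R),
  derive1n r.+2 M t =
  2 ^+ r.+1 * r.+1`!%:R *
  \sum_(i < d) lambda i ^+ r.+2 * (1 - 2 * (t * lambda i))^-1 ^+ r.+2.
Proof.
elim: r => [|r IH].
  apply: (near_derive1 derive1_cgf_near0); near=> t.
  have tpos : forall i, 0 < 1 - 2 * (t * lambda i).
    by near: t; exact: near0_1sub_gt0.
  rewrite -fct_sumE mulr_sumr.
  apply: is_derive_sum => i.
  have dV := is_derive_1subV (lt0r_neq0 (tpos i)).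
  rewrite (_ : (fun s => _) =
    lambda i \*: (fun s => (1 - 2 * (s * lambda i))^-1) - cst (lambda i));
    last by apply/funext => s; rewrite !fctE.
  apply: is_derive_eq; rewrite /GRing.scale /=.
  by rewrite (_ : 1`!%:R = 1 :> R) //; ring.
apply: (near_derive1 IH); near=> t.
have tpos : forall i, 0 < 1 - 2 * (t * lambda i).
  by near: t; exact: near0_1sub_gt0.
pose h i := (2 ^+ r.+1 * r.+1`!%:R * lambda i ^+ r.+2) \*:
  (fun s => (1 - 2 * (s * lambda i))^-1) ^+ r.+2.
rewrite (_ : (fun s => _) = \sum_(i < d) h i); last first.
  apply/funext => s; rewrite fct_sumE mulr_sumr; apply: eq_bigr => i _.
  by rewrite /h !fctE /= mulrA.
rewrite mulr_sumr; apply: is_derive_sum => i.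
have dV := is_derive_1subV (lt0r_neq0 (tpos i)).
apply: is_derive_eq; rewrite /GRing.scale /=.
rewrite (factS r.+1) natrM (exprS 2 r.+1).
move: (r.+2%:R) (r.+1`!%:R) (_^-1) (2 ^+ _) => n c u a; by rewrite !exprS; ring.
Unshelve. all: by end_near. Qed.

Lemma derive1n_cgf0 r :
  derive1n r.+2 M 0 = 2 ^+ r.+1 * r.+1`!%:R * \sum_(i < d) lambda i ^+ r.+2.
Proof.
rewrite (nbhs_singleton (derive1n_cgf_near0 r)); congr *%R.
by apply: eq_bigr => i _; rewrite mul0r mulr0 subr0 invr1 expr1n mulr1.
Qed.

End Cgf.

(** * Integration against the image of a weighted measure *)

Section Weighted.
Local Open Scope classical_set_scope.
Local Open Scope ereal_scope.
Context d1 d2 (X : measurableType d1) (Y : measurableType d2) (R : realType).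
Import HBNNSimple.
Variables (mu : {measure set X -> \bar R}) (nu : {measure set Y -> \bar R}).
Variables (w : X -> R) (phi : X -> Y).
Hypotheses (mw : measurable_fun [set: X] w) (w0 : forall x, (0 <= w x)%R).
Hypothesis mphi : measurable_fun [set: X] phi.

Hypothesis nuE : forall B, measurable B ->
  \int[mu]_x (w x * \1_B (phi x))%:E = nu B.

(** [nuE] says that [nu] is the image under [phi] of the measure with density [w] with respect to
    [mu]. Equality on indicators extends to simple functions by linearity and to [g] by monotone
    convergence, as [w >= 0] keeps the approximations increasing. *)
Lemma ge0_integral_weighted_pushforward (g : Y -> R) :
  measurable_fun [set: Y] g -> (forall y, (0 <= g y)%R) ->
  \int[mu]_x (w x * g (phi x))%:E = \int[nu]_y (g y)%:E.
Proof.
move=> mg g0.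
have mEg : measurable_fun [set: Y] (fun y => (g y)%:E).
  by exact/measurable_EFinP.
pose f_ := nnsfun_approx measurableT mEg.
have f_cvg y : (f_ n y)%:E @[n --> \oo] --> (g y)%:E.
  by apply: (cvg_nnsfun_approx measurableT mEg) => // z _; rewrite lee_fin.
have f_nd y m n : (m <= n)%N -> (f_ m y <= f_ n y)%R.
  by move=> mn; exact/lefP/nd_nnsfun_approx.
have mfphi n : measurable_fun [set: X] (fun x => (w x * f_ n (phi x))%R).
  by apply: measurable_funM => //; apply: measurableT_comp.
transitivity (limn (fun n => \int[nu]_y (f_ n y)%:E)); last first.
  rewrite -monotone_convergence//.
  - by apply: eq_integral => y _; apply/cvg_lim.
  - by move=> n; exact/measurable_EFinP.
  - by move=> n y _; rewrite lee_fin.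
  - by move=> y _ m n mn; rewrite lee_fin f_nd.
transitivity (limn (fun n => \int[mu]_x (w x * f_ n (phi x))%:E)).
  rewrite -monotone_convergence//.
  - apply: eq_integral => x _; apply/esym/cvg_lim => //.
    under eq_fun do rewrite EFinM.
    by rewrite EFinM; apply: cvgeZl.
  - by move=> n; exact/measurable_EFinP.
  - by move=> n y _; rewrite lee_fin mulr_ge0.
  - by move=> y _ m n mn; rewrite lee_fin ler_wpM2l// f_nd.
congr (limn _); apply/funext => n.
have mf_ r : measurable (f_ n @^-1` [set r]) by exact: measurable_sfunP.
under eq_integral => x _.
  rewrite EFinM fimfunE -fsumEFin// ge0_mule_fsumr; last first.
    by move=> r; rewrite EFinM nnfun_muleindic_ge0.
  over.
under [RHS]eq_integral => y _ do rewrite fimfunE -fsumEFin//.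
rewrite ge0_integral_fsum//; last 2 first.
- move=> r; apply: emeasurable_funM; first exact/measurable_EFinP.
  apply/measurable_EFinP/measurable_funM => //.
  exact: measurableT_comp.
- move=> r x _; apply: mule_ge0; first by rewrite lee_fin.
  by rewrite EFinM nnfun_muleindic_ge0.
rewrite [RHS]ge0_integral_fsum//; last 2 first.
- by move=> r; exact/measurable_EFinP/measurable_funM.
- by move=> r y _; rewrite EFinM nnfun_muleindic_ge0.
apply: eq_fsbigr => r _.
rewrite integralZl_indic_nnsfun// integral_indic// setIT -nuE//.
(* [f_ n] is non-negative, so the level set of a negative [r] is empty and both sides vanish;
   pulling out the scalar requires [0 <= r]. *)
have [r0|r0] := ltP r 0%R.
  rewrite preimage_nnfun0 ?indic0//.
  by rewrite !integral0_eq ?mule0// => x _; rewrite ?mulr0 ?mule0.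
rewrite -ge0_integralZl_EFin//.
- by apply: eq_integral => x _; rewrite !EFinM muleCA.
- by move=> x _; rewrite lee_fin mulr_ge0.
- by apply/measurable_EFinP/measurable_funM => //; exact: measurableT_comp.
Qed.

End Weighted.

(** * Expectation of a product of functions of independent variables *)

Section Independence.
Local Open Scope classical_set_scope.
Local Open Scope ereal_scope.
Context (disp : measure_display) (T : measurableType disp) (R : realType).
Variables (P : probability T R) (I : finType) (X : I -> {RV P >-> R}).
Hypothesis X_indep : mutually_independent X.

(* Indicators are replaced by general functions one index at a time; [s] lists
   the indices already treated. *)
Lemma integral_prod_indep_rec (s : seq I) (h : I -> R -> R) (e : I -> R) :
  (forall i, measurable_fun [set: R] (h i)) ->
  (forall i y, (0 <= h i y)%R) ->
  (forall i, i \notin s -> exists2 B, measurable B & h i = \1_B) ->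
  (forall i, \int[P]_x (h i (X i x))%:E = (e i)%:E) ->
  \int[P]_x (\prod_i h i (X i x))%:E = (\prod_i e i)%:E.
Proof.
elim: s h e => [|j s IH] h e mh h0 hB he.
  (* With no index treated, every [h i] is an indicator and the claim is independence for the full
     index set. *)
  pose B i := projT1 (cid2 (hB i isT)).
  have BP i : measurable (B i) /\ h i = \1_(B i).
    by rewrite /B; case: cid2.
  have mXB i : measurable (X i @^-1` B i).
    by have [mB _] := BP i; rewrite -[_ @^-1` _]setTI; exact: measurable_funP.
  have eE i : P (X i @^-1` B i) = (e i)%:E.
    rewrite -he; have [_ ->] := BP i.
    by rewrite -[X in P X = _]setIT -integral_indic.
  transitivity
    (P (\bigcap_(i in [set i | i \in [set: I]%SET]) (X i @^-1` B i))).
    rewrite -[in RHS](setIT (\bigcap_(i in _) _)) -integral_indic//; last first.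
      by apply: fin_bigcap_measurable => //; exact: finite_finset.
    apply: eq_integral => x _; congr EFin.
    rewrite indicE; case: (boolP (x \in _)) => [|/negP xB].
      rewrite inE => xB; apply: big1 => i _.
      have [_ ->] := BP i; rewrite indicE mem_set//.
      by apply: xB => /=; rewrite inE.
    have [i xBi] : exists i, ~ B i (X i x).
      by apply/existsNP => xB'; apply: xB; rewrite inE => i _; exact: xB'.
    rewrite (bigD1 i)//=; have [_ ->] := BP i.
    by rewrite indicE memNset// mul0r.
  rewrite X_indep; last by move=> i _; have [] := BP i.
  rewrite -prodEFin; apply: eq_big => [i|i _]; first by rewrite inE.
  exact: eE.
have mhX i : measurable_fun [set: T] (fun x => h i (X i x)).
  exact: measurableT_comp.
have e0 i : (0 <= e i)%R.
  by rewrite -lee_fin -he; apply: integral_ge0 => x _; rewrite lee_fin.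
have c0 : (0 <= \prod_(i | i != j) e i)%R by apply: prodr_ge0 => i _.
transitivity (\int[P]_x ((\prod_(i | i != j) h i (X i x)) * h j (X j x))%:E).
  by apply: eq_integral => x _; rewrite (bigD1 j)//= mulrC.
(* The factors other than [j] act as a weight; the weighted image under [X j] should be the law of
   [X j] scaled by the product of the other [e i], which need only be checked on indicators. *)
rewrite (@ge0_integral_weighted_pushforward _ _ _ _ _ P
  (mscale (NngNum c0) (distribution P (X j)))
  (fun x => \prod_(i | i != j) h i (X i x))%R (X j)) //.
- rewrite ge0_integral_mscale//=.
  + rewrite ge0_integral_distribution//; first last.
    * by move=> y; rewrite lee_fin.
    * exact/measurable_EFinP.
    by rewrite [X in _ * X]he -EFinM [in RHS](bigD1 j)//= mulrC.
  + exact/measurable_EFinP.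
  + by move=> y _; rewrite lee_fin.
- under eq_fun do rewrite -big_filter.
  exact: measurable_prod.
- by move=> x; apply: prodr_ge0.
- move=> B mB.
  (* Putting [\1_B] at [j] confines the general functions to indices in [s], so the induction
     hypothesis applies. *)
  pose h' i : R -> R := if i == j then \1_B else h i.
  pose e' i := if i == j then fine (P (X j @^-1` B)) else e i.
  have mXB : measurable (X j @^-1` B).
    by rewrite -[_ @^-1` _]setTI; exact: measurable_funP.
  transitivity (\int[P]_x (\prod_i h' i (X i x))%:E).
    apply: eq_integral => x _; congr EFin.
    rewrite [RHS](bigD1 j)//= /h' eqxx mulrC; congr *%R.
    by apply: eq_bigr => i /negbTE ->.
  rewrite (IH h' e').
  + rewrite (bigD1 j)//= /e' eqxx mulrC EFinM fineK ?fin_num_measure//.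
    by congr (_%:E * _); apply: eq_bigr => i /negbTE ->.
  + by move=> i; rewrite /h'; case: eqP => // _; exact: measurable_indic.
  + by move=> i y; rewrite /h'; case: eqP.
  + move=> i si; rewrite /h'; case: eqP => [_|/eqP ij]; first by exists B.
    by apply: hB; rewrite inE negb_or ij.
  + move=> i; rewrite /h' /e'; case: eqP => // ->.
    by rewrite fineK ?fin_num_measure// -[X in _ = P X]setIT -integral_indic.
Qed.

Lemma integral_prod_indep (h : I -> R -> R) (e : I -> R) :
  (forall i, measurable_fun [set: R] (h i)) ->
  (forall i y, (0 <= h i y)%R) ->
  (forall i, \int[P]_x (h i (X i x))%:E = (e i)%:E) ->
  \int[P]_x (\prod_i h i (X i x))%:E = (\prod_i e i)%:E.
Proof.
move=> mh h0; apply: (integral_prod_indep_rec (s := enum I)) => // i.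
by rewrite mem_enum inE.
Qed.

End Independence.

(** * Gaussian integrals *)

Section Gaussian.
Local Open Scope ereal_scope.
Context (disp : measure_display) (T : measurableType disp) (R : realType).
Variables (P : probability T R).

Lemma integral_standard_gaussian (X : {RV P >-> R}) (g : R -> R) :
  standard_gaussian X -> measurable_fun [set: R]%classic g ->
  (forall y, (0 <= g y)%R) ->
  \int[P]_x (g (X x))%:E =
  \int[lebesgue_measure]_y (normal_pdf 0 1 y * g y)%:E.
Proof.
move=> gX mg g0.
rewrite -(@ge0_integral_distribution _ _ _ _ _ _ X (fun y => (g y)%:E));
  first last.
- by move=> y; rewrite lee_fin.
- exact/measurable_EFinP.
apply/esym.
(* Lebesgue measure lives on a copy of [R] carrying another measure display, so
   the identity between the two copies is used as the pushforward map. *)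
have mid : @measurable_fun _ _ (measurableTypeR R) R setT id.
  by move=> _ B mB; rewrite setTI; exact: mB.
rewrite -(@ge0_integral_weighted_pushforward _ _ (measurableTypeR R) R R
  lebesgue_measure (distribution P X) (normal_pdf 0 1) id)//.
- exact: measurable_normal_pdf.
- by move=> x; exact: normal_pdf_ge0.
- move=> B mB; rewrite [RHS]gX// /normal_prob [RHS]integral_mkcond.
  by apply: eq_integral => x _; rewrite epatch_indic EFinM.
Qed.

Lemma integral_expR_centered_square (X : {RV P >-> R}) (s : R) :
  standard_gaussian X -> (0 < 1 - 2 * s)%R ->
  \int[P]_x (expR (s * (X x ^+ 2 - 1)))%:E =
  (expR (- s - ln (1 - 2 * s) / 2))%:E.
Proof.
move=> gX s1.
(* Chosen so that [- y^2 / 2 + s y^2 = - y^2 / (2 sigma^2)]: the integrand is then [exp (- s) sigma]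
   times the centred normal density of variance [sigma^2], whose integral is 1. *)
pose sigma := Num.sqrt (1 - 2 * s)^-1.
have sigma0 : (0 < sigma)%R by rewrite sqrtr_gt0 invr_gt0.
have sigma2 : (sigma ^+ 2 = (1 - 2 * s)^-1)%R.
  by rewrite sqr_sqrtr// invr_ge0 ltW.
rewrite (@integral_standard_gaussian _ (fun y => expR (s * (y ^+ 2 - 1))))//;
  last first.
  apply: measurableT_comp => //; apply: measurable_funM => //.
  by apply: measurable_funB => //; exact: measurable_funX.
have eE : (expR (- s - ln (1 - 2 * s) / 2) = expR (- s) * sigma)%R.
  rewrite expRD; congr *%R.
  have : (ln (sigma ^+ 2) = - ln (1 - 2 * s))%R by rewrite sigma2 lnV.
  rewrite lnXn// => h; rewrite -[RHS]lnK ?posrE//; congr expR; lra.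
pose q : R := Num.sqrt (pi *+ 2).
have q0 : q != 0%R by rewrite gt_eqF// sqrtr_gt0 pmulrn_lgt0// pi_gt0.
have peakE (t : R) : (0 < t)%R -> (normal_peak t = (t * q)^-1)%R.
  move=> t0; rewrite /normal_peak -mulrnAr sqrtrM ?sqr_ge0//.
  by rewrite sqrtr_sqr gtr0_norm.
transitivity (\int[lebesgue_measure]_y
    ((expR (- s) * sigma)%:E * (normal_pdf 0 sigma y)%:E)).
  apply: eq_integral => y _; rewrite -EFinM; congr EFin.
  rewrite !normal_pdfE ?gt_eqF// !peakE// /normal_fun mul1r -mulrA -expRD.
  have -> : (- (y - 0) ^+ 2 / (1 ^+ 2 *+ 2) + s * (y ^+ 2 - 1) =
             - s + - (y - 0) ^+ 2 / (sigma ^+ 2 *+ 2))%R.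
    by rewrite sigma2; field; rewrite gt_eqF.
  by rewrite expRD; field; rewrite q0 gt_eqF.
rewrite ge0_integralZl_EFin//.
- by rewrite integral_normal_pdf mule1 eE.
- by move=> x _; rewrite lee_fin normal_pdf_ge0.
- apply: measurableT_comp => //; exact: measurable_normal_pdf.
- by rewrite mulr_ge0// ?expR_ge0 ?ltW.
Qed.

End Gaussian.

(** * Cumulants of [F_infty] and the conclusion *)

Section CumulantsOfChaos.
Variables (R : realType) (disp : measure_display) (T : measurableType disp).
Variables (P : probability T R) (d : nat) (lambda : 'I_d -> R).
Variable N : 'I_d -> {RV P >-> R}.
Hypothesis N_indep : mutually_independent N.
Hypothesis N_gauss : forall i, standard_gaussian (N i).

(** [exp (t F)] is a product of non-negative functions of the independent [N i], so its expectation
    factorises. The value is a finite exponential, hence [fine] loses nothing and [ln] undoes it. *)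
Lemma cgf_F_infty_near0 : \forall t \near (0 : R),
  ln (fine (mmt_gen_fun P (F_infty lambda N) t)) =
  \sum_(i < d) (- (t * lambda i) - ln (1 - 2 * (t * lambda i)) / 2).
Proof.
near=> t.
have tpos : forall i, 0 < 1 - 2 * (t * lambda i).
  by near: t; exact: near0_1sub_gt0.
rewrite /mmt_gen_fun unlock.
under eq_integral => x _.
  rewrite /= /F_infty mulr_suml expR_sum.
  under eq_bigr => i _ do rewrite mulrC mulrA.
  over.
rewrite /=.
rewrite (integral_prod_indep N_indep
  (h := fun i y => expR (t * lambda i * (y ^+ 2 - 1)))
  (e := fun i => expR (- (t * lambda i) - ln (1 - 2 * (t * lambda i)) / 2))).
- by rewrite /= -expR_sum expRK.
- move=> i; apply: measurableT_comp => //; apply: measurable_funM => //.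
  by apply: measurable_funB => //; exact: measurable_funX.
- by move=> i y; exact: expR_ge0.
- by move=> i; exact: integral_expR_centered_square.
Unshelve. all: by end_near. Qed.

Lemma cumulant_F_infty (r : nat) :
  cumulant P (F_infty lambda N) r.+2 =
  2 ^+ r.+1 * r.+1`!%:R * \sum_(i < d) lambda i ^+ r.+2.
Proof. exact: (derive1n_cgf0 cgf_F_infty_near0). Qed.

End CumulantsOfChaos.

Theorem proposition2p2 (R : realType) (disp : measure_display)
    (T : measurableType disp) (P : probability T R)
    (d : nat) (hd : (1 <= d)%N)
    (lambda : 'I_d -> R)
    (lambda_neq0 : forall i : 'I_d, lambda i != 0)
    (lambda_inj : injective lambda)
    (N : 'I_d -> {RV P >-> R})
    (N_indep : mutually_independent N)
    (N_gauss : forall i : 'I_d, standard_gaussian (N i)) :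
  exists2 K : R, K != 0 &
    forall f : R -> R, smooth f ->
      forall x : R, malliavin_op lambda N f x = K * fourier_op lambda f x.
Proof.
(* Dictated by the terms in [f] itself: [- a_(d+1) x f] against [x f], where [a_(d+1) = 2^(-d)]
   because [P_poly] is monic. *)
exists (- (2 ^+ d)^-1).
  by rewrite oppr_eq0 invr_eq0 expf_neq0// pnatr_eq0.
move=> f _ x; apply: malliavin_op_fourier_op => // r.
exact: cumulant_F_infty.
Qed.
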